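(* Let $H$ be a Hopf algebra over a field $k$, let $e\in H$ be a subcentral idempotent and let $(W,\rho^W)$ be a right $\bar H_e$-comodule. Then the cotensor product $W\,\square^{\bar H_e}He$ is a right partial $H$-comodule by $$\rho: W\,\square^{\bar H_e}He\to (W\,\square^{\bar H_e}He)\otimes H,\qquad \sum_i w_i\otimes x_i\mapsto\sum_i w_i\otimes {x_i}_{(1)}e\otimes {x_i}_{(2)}.$$
   Context: $H$ has comultiplication $\Delta(h)=h_{(1)}\otimes h_{(2)}$ (Sweedler notation), counit $\epsilon$ and antipode $S$. A right (algebraic) partial $H$-comodule is a $k$-vector space $M$ with a linear map $\rho:M\to M\otimes H$, $\rho(m)=m^{(0)}\otimes m^{(1)}$, such that for all $m\in M$: (1) $m^{(0)}\epsilon(m^{(1)})=m$; (2) $m^{(0)(0)}\otimes {m^{(0)(1)}}_{(1)}\otimes {m^{(0)(1)}}_{(2)}S(m^{(1)}) = m^{(0)(0)(0)}\otimes m^{(0)(0)(1)}\otimes m^{(0)(1)}S(m^{(1)})$; (3) $m^{(0)(0)}\otimes m^{(0)(1)}S({m^{(1)}}_{(1)})\otimes {m^{(1)}}_{(2)} = m^{(0)(0)(0)}\otimes m^{(0)(0)(1)}S(m^{(0)(1)})\otimes m^{(1)}$. A right coideal subalgebra of $H$ is a subalgebra $A$ with $\Delta(A)\subseteq A\otimes H$. A subcentral idempotent of $H$ is a nonzero idempotent $e\in H$ with $ee_{(1)}\otimes e_{(2)}=e_{(1)}e\otimes e_{(2)}$. For such $e$, $A_e$ is the smallest right coideal subalgebra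 of $H$ containing $e$, $A_e^+=A_e\cap\ker\epsilon$, and $\bar H_e=H/HA_e^+$. Since $HA_e^+$ is a left ideal and a two-sided coideal, $\bar H_e$ is a coalgebra and a left $H$-module, and the projection $\pi_e:H\to\bar H_e$ is a left $H$-linear coalgebra map. The left ideal $He$ is a left $\bar H_e$-comodule by restriction of $(\pi_e\otimes H)\Delta$. For a right $\bar H_e$-comodule $W$ (coaction $w\mapsto w^{(0)}\otimes w^{(1)}$), the cotensor product is the vector space $$W\,\square^{\bar H_e}He=\Big\{\textstyle\sum_i w_i\otimes x_i\in W\otimes He \;:\; \sum_i w_i^{(0)}\otimes w_i^{(1)}\otimes x_i=\sum_i w_i\otimes\pi_e({x_i}_{(1)})\otimes {x_i}_{(2)}\Big\}.$$ *)

(* Defs.v *)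
From HB Require Import structures.
From mathcomp Require Import all_boot all_algebra.
From mathcomp Require Import boolp classical_sets.

Set Implicit Arguments.
Unset Strict Implicit.
Unset Printing Implicit Defensive.

Import GRing.Theory.
Local Open Scope quotient_scope.
Local Open Scope ring_scope.

(* [tensor U V] is the free commutative monoid on [U * V] modulo the usual
   bilinearity relations; a formal sum of pure tensors is a list of pairs. *)
Section TensorDef.
Context {k : fieldType} (U V : lmodType k).
Implicit Types (s t : seq (U * V)).

Inductive tensor_eqv : seq (U * V) -> seq (U * V) -> Prop :=
| TensorRefl s : tensor_eqv s s
| TensorSym s t : tensor_eqv s t -> tensor_eqv t s
| TensorTrans s t r : tensor_eqv s t -> tensor_eqv t r -> tensor_eqv s r
| TensorCat s s' t t' :
    tensor_eqv s s' -> tensor_eqv t t' -> tensor_eqv (s ++ t) (s' ++ t')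
| TensorCatC s t : tensor_eqv (s ++ t) (t ++ s)
| TensorDl u u' v : tensor_eqv [:: (u + u', v)] [:: (u, v); (u', v)]
| TensorDr u v v' : tensor_eqv [:: (u, v + v')] [:: (u, v); (u, v')]
| TensorZ a u v : tensor_eqv [:: (a *: u, v)] [:: (u, a *: v)]
| Tensor0 v : tensor_eqv [:: (0, v)] [::].

Definition tensor_rel s t := `[< tensor_eqv s t >].

Lemma tensor_rel_equiv : equiv_class_of tensor_rel.
Proof.
split=> [s|s t|t s r]; rewrite /tensor_rel.
- by apply/asboolP; exact: TensorRefl.
- by apply/asboolP/asboolP; exact: TensorSym.
- by move=> /asboolP st /asboolP tr; apply/asboolP; exact: TensorTrans st tr.
Qed.

Canonical tensor_equiv := EquivRelPack tensor_rel_equiv.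
Canonical tensor_encModRel := defaultEncModRel tensor_rel.

Definition tensor := {eq_quot tensor_rel}.
HB.instance Definition _ : EqQuotient _ tensor_rel tensor :=
  EqQuotient.on tensor.
HB.instance Definition _ := Choice.on tensor.

Definition tclass s : tensor := \pi_tensor s.

Lemma tclassP s t : tclass s = tclass t <-> tensor_eqv s t.
Proof.
by split=> [/eqmodP/asboolP|st]; [|apply/eqmodP/asboolP].
Qed.

Lemma tclass_repr (x : tensor) : tclass (repr x) = x.
Proof. exact: reprK. Qed.

Definition tensor_add (x y : tensor) : tensor := tclass (repr x ++ repr y).
Definition tensor_scale (a : k) (x : tensor) : tensor :=
  tclass [seq (a *: p.1, p.2) | p <- repr x].
Definition tensor_opp (x : tensor) : tensor := tensor_scale (-1) x.
Definition tensor_zero : tensor := tclass [::].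

Lemma tclassD s t : tensor_add (tclass s) (tclass t) = tclass (s ++ t).
Proof.
by apply/tclassP; apply: TensorCat; apply/tclassP; rewrite tclass_repr.
Qed.

Lemma tensor_eqvZ a s t : tensor_eqv s t ->
  tensor_eqv [seq (a *: p.1, p.2) | p <- s] [seq (a *: p.1, p.2) | p <- t].
Proof.
elim=> {s t} [s|s t _|s t r _ h1 _ h2|s s' t t' _ h1 _ h2|s t|u u' v|u v v'|b u v|v] /=.
- exact: TensorRefl.
- exact: TensorSym.
- exact: TensorTrans h1 h2.
- by rewrite !map_cat; exact: TensorCat.
- by rewrite !map_cat; exact: TensorCatC.
- by rewrite scalerDr; exact: TensorDl.
- exact: TensorDr.
- by rewrite scalerA mulrC -scalerA; exact: TensorZ.
- by rewrite scaler0; exact: Tensor0.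
Qed.

Lemma tclassZ a s :
  tensor_scale a (tclass s) = tclass [seq (a *: p.1, p.2) | p <- s].
Proof.
by apply/tclassP; apply: tensor_eqvZ; apply/tclassP; rewrite tclass_repr.
Qed.

Lemma tensor_addA : associative tensor_add.
Proof.
move=> x y z; rewrite -[x]tclass_repr -[y]tclass_repr -[z]tclass_repr.
by rewrite !tclassD catA.
Qed.

Lemma tensor_addC : commutative tensor_add.
Proof.
move=> x y; rewrite -[x]tclass_repr -[y]tclass_repr !tclassD.
by apply/tclassP; exact: TensorCatC.
Qed.

Lemma tensor_add0 : left_id tensor_zero tensor_add.
Proof. by move=> x; rewrite -[x]tclass_repr tclassD. Qed.

Lemma tensor_scaleDl x a b :
  tensor_scale (a + b) x = tensor_add (tensor_scale a x) (tensor_scale b x).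
Proof.
rewrite -[x]tclass_repr !tclassZ tclassD; move: (repr x) => {x} s.
apply/tclassP; elim: s => [|[u v] s ih] /=; first exact: TensorRefl.
rewrite scalerDl.
move: [seq _ | _ <- s] [seq _ | _ <- s] [seq _ | _ <- s] ih => s1 s2 s3 ih.
apply: (TensorTrans (TensorCat (TensorDl (a *: u) (b *: u) v) ih)).
rewrite -[X in tensor_eqv _ X]cat1s -[_ :: s1]cat1s -[[:: _; _]]cat1s -!catA.
apply: TensorCat; first exact: TensorRefl.
rewrite !catA; apply: TensorCat; last exact: TensorRefl.
exact: TensorCatC.
Qed.

Lemma tensor_scale0 x : tensor_scale 0 x = tensor_zero.
Proof.
rewrite -[x]tclass_repr tclassZ; apply/tclassP.
elim: (repr x) => [|[u v] s ih] /=; first exact: TensorRefl.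
by rewrite scale0r; exact: TensorCat (Tensor0 v) ih.
Qed.

Lemma tensor_scale1 : left_id 1 tensor_scale.
Proof.
move=> x; rewrite -[x]tclass_repr tclassZ; congr tclass.
by rewrite -[RHS]map_id; apply: eq_map => -[u v]; rewrite /= scale1r.
Qed.

Lemma tensor_scaleA a b x :
  tensor_scale a (tensor_scale b x) = tensor_scale (a * b) x.
Proof.
rewrite -[x]tclass_repr !tclassZ -map_comp; congr tclass.
by apply: eq_map => -[u v]; rewrite /= scalerA.
Qed.

Lemma tensor_scaleDr : right_distributive tensor_scale tensor_add.
Proof.
move=> a x y; rewrite -[x]tclass_repr -[y]tclass_repr !(tclassD, tclassZ).
by rewrite map_cat.
Qed.

Lemma tensor_addN : left_inverse tensor_zero tensor_opp tensor_add.
Proof.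
move=> x; rewrite /tensor_opp -[X in tensor_add _ X]tensor_scale1.
by rewrite -tensor_scaleDl addNr tensor_scale0.
Qed.

HB.instance Definition _ := GRing.isZmodule.Build tensor
  tensor_addA tensor_addC tensor_add0 tensor_addN.
HB.instance Definition _ := GRing.Zmodule_isLmodule.Build k tensor
  tensor_scaleA tensor_scale1 tensor_scaleDr
  (fun x a b => tensor_scaleDl x a b).

Definition tpure (u : U) (v : V) : tensor := tclass [:: (u, v)].

End TensorDef.

Notation "u \ox v" := (tpure u v) (at level 40, left associativity) : ring_scope.
Notation "U \ox V" := (tensor U V) (at level 40, left associativity) : type_scope.

Section TensorTheory.
Context {k : fieldType}.
Implicit Types (U V W X : lmodType k).

Lemma tclass_sum U V (s : seq (U * V)) :
  tclass s = \sum_(p <- s) p.1 \ox p.2.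
Proof.
elim: s => [|[u v] s ih]; first by rewrite big_nil.
by rewrite big_cons -ih -cat1s -tclassD.
Qed.

Lemma tensor_sum U V (t : U \ox V) : t = \sum_(p <- repr t) p.1 \ox p.2.
Proof. by rewrite -tclass_sum tclass_repr. Qed.

Lemma tpure_bilinear U V : bilinear_for *:%R *:%R (@tpure k U V).
Proof.
have DL u u' v : (u + u') \ox v = u \ox v + u' \ox v :> U \ox V.
  by rewrite [RHS]tclassD; apply/tclassP; exact: TensorDl.
have DR u v v' : u \ox (v + v') = u \ox v + u \ox v' :> U \ox V.
  by rewrite [RHS]tclassD; apply/tclassP; exact: TensorDr.
have ZL a u v : (a *: u) \ox v = a *: (u \ox v) :> U \ox V.
  by rewrite [RHS]tclassZ.
have ZR a u v : u \ox (a *: v) = a *: (u \ox v) :> U \ox V.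
  by rewrite -ZL; apply/tclassP; exact/TensorSym/TensorZ.
by split=> [v a u u'|u a v v'] /=; rewrite ?DL ?DR ?ZL ?ZR.
Qed.

HB.instance Definition _ U V :=
  bilinear_isBilinear.Build k U V (tensor U V) _ _ (@tpure k U V)
    (tpure_bilinear U V).

(* The linear extension of a bilinear map to the tensor product. It is only
   meaningful for bilinear [f]: see [tlift_pure] and [tlift_is_linear]. *)
Definition tlift U V X (f : U -> V -> X) (t : U \ox V) : X :=
  \sum_(p <- repr t) f p.1 p.2.

End TensorTheory.

Arguments tlift : simpl never.

(* Sweedler-style sums: for [t = \sum_i u_i \ox v_i] and [E] bilinear in [x]
   and [y], this is [\sum_i E(u_i, v_i)]. *)
Notation "\tsum_ ( x \ox y <- t ) E" := (tlift (fun x y => E) t)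
  (at level 41, x name, y name, t at level 50, E at level 41,
   format "\tsum_ ( x  \ox  y  <-  t )  E") : ring_scope.

Section LiftTheory.
Context {k : fieldType}.
Implicit Types (U V W X Y : lmodType k).

Lemma linear_zero X Y (g : X -> Y) : linear g -> g 0 = 0.
Proof.
by move=> lg; have := lg (-1) 0 0; rewrite !scaleN1r !addNr.
Qed.

Lemma tlift_class U V X (f : U -> V -> X) : bilinear_for *:%R *:%R f ->
  forall s, tlift f (tclass s) = \sum_(p <- s) f p.1 p.2.
Proof.
move=> [fl fr] s.
have st : tensor_eqv (repr (tclass s)) s by apply/tclassP; rewrite tclass_repr.
rewrite /tlift; move: (repr _) st => t.
have f0 v : f 0 v = 0.
  exact: linear_zero (fl v).
have f0r u : f u 0 = 0.
  exact: linear_zero (fr u).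
elim=> {t s} [s|s t _|s t r _ h1 _ h2|s s' t t' _ h1 _ h2|s t|u u' v|u v v'|b u v|v] //.
- by rewrite h1.
- by rewrite !big_cat h1 h2.
- by rewrite !big_cat /= addrC.
- rewrite !big_cons !big_nil /= !addr0.
  by have /= := fl v 1 u u'; rewrite !scale1r.
- rewrite !big_cons !big_nil /= !addr0.
  by have /= := fr u 1 v v'; rewrite !scale1r.
- rewrite !big_cons !big_nil /= !addr0.
  by have /= := fl v b u 0; have /= := fr u b v 0; rewrite !addr0 f0 f0r !addr0 => -> ->.
- by rewrite big_cons !big_nil /= f0 addr0.
Qed.

Lemma tlift_pure U V X (f : U -> V -> X) : bilinear_for *:%R *:%R f ->
  forall u v, tlift f (u \ox v) = f u v.
Proof. by move=> bf u v; rewrite tlift_class // big_seq1. Qed.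

Lemma tlift_is_linear U V X (f : U -> V -> X) : bilinear_for *:%R *:%R f ->
  linear (tlift f).
Proof.
move=> bf a s t; rewrite -[s]tclass_repr -[t]tclass_repr.
rewrite [a *: _]tclassZ [_ + tclass (repr t)]tclassD.
rewrite !tlift_class // big_cat big_map scaler_sumr; congr (_ + _).
apply: eq_bigr => -[u v] _ /=.
have f0 : f 0 v = 0.
  exact: linear_zero (bf.1 v).
by have /= := bf.1 v a u 0; rewrite f0 !addr0.
Qed.

Lemma linear_tlift U V X Y (g : X -> Y) (f : U -> V -> X) t : linear g ->
  g (tlift f t) = \tsum_(u \ox v <- t) g (f u v).
Proof.
move=> lg; have g0 : g 0 = 0.
  exact: linear_zero.
have gD : {morph g : x y / x + y} by move=> x y; have := lg 1 x y; rewrite !scale1r.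
by rewrite /tlift (big_morph g gD g0).
Qed.

Lemma tlift_linear_fun U V X Y (F : Y -> U -> V -> X) t :
  (forall u v, linear (fun y => F y u v)) -> linear (fun y => tlift (F y) t).
Proof.
move=> lF a y z; rewrite /tlift scaler_sumr -big_split.
by apply: eq_bigr => p _; rewrite lF.
Qed.

Lemma eq_tlift U V X (f g : U -> V -> X) t :
  (forall u v, f u v = g u v) -> tlift f t = tlift g t.
Proof. by move=> fg; apply: eq_bigr => p _. Qed.

Lemma tlift_id U V (t : U \ox V) : \tsum_(u \ox v <- t) (u \ox v) = t.
Proof. by rewrite [RHS]tensor_sum. Qed.

End LiftTheory.

HB.mixin Record isCoalgebra (k : fieldType) C of GRing.Lmodule k C := {
  comul_subdef : {linear C -> tensor C C};
  counit_subdef : {scalar C};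
  comulA_subproof : forall c,
    \tsum_(c1 \ox c2 <- comul_subdef c) \tsum_(x \ox y <- comul_subdef c1)
      (x \ox y \ox c2)
    = \tsum_(c1 \ox c2 <- comul_subdef c) \tsum_(y \ox z <- comul_subdef c2)
      (c1 \ox y \ox z);
  counitl_subproof : forall c,
    \tsum_(c1 \ox c2 <- comul_subdef c) (counit_subdef c1 *: c2) = c;
  counitr_subproof : forall c,
    \tsum_(c1 \ox c2 <- comul_subdef c) (counit_subdef c2 *: c1) = c
}.

#[short(type="coalgType")]
HB.structure Definition Coalgebra (k : fieldType) :=
  {C of GRing.Lmodule k C & isCoalgebra k C}.

Section CoalgebraTheory.
Context {k : fieldType} {C : coalgType k}.

Definition comul : {linear C -> tensor C C} := comul_subdef.
Definition counit : {scalar C} := counit_subdef.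

Lemma comulA (c : C) :
  \tsum_(c1 \ox c2 <- comul c) \tsum_(x \ox y <- comul c1) (x \ox y \ox c2)
  = \tsum_(c1 \ox c2 <- comul c) \tsum_(y \ox z <- comul c2) (c1 \ox y \ox z).
Proof. exact: comulA_subproof. Qed.

Lemma counitl (c : C) : \tsum_(c1 \ox c2 <- comul c) (counit c1 *: c2) = c.
Proof. exact: counitl_subproof. Qed.

Lemma counitr (c : C) : \tsum_(c1 \ox c2 <- comul c) (counit c2 *: c1) = c.
Proof. exact: counitr_subproof. Qed.

End CoalgebraTheory.

HB.mixin Record isHopfAlgebra (k : fieldType) H
    of GRing.Algebra k H & Coalgebra k H := {
  comul1_subproof : comul (1 : H) = 1 \ox 1;
  comulM_subproof : forall x y : H, comul (x * y) =
    \tsum_(x1 \ox x2 <- comul x) \tsum_(y1 \ox y2 <- comul y)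
      ((x1 * y1) \ox (x2 * y2));
  counit1_subproof : counit (1 : H) = 1;
  counitM_subproof : forall x y : H, counit (x * y) = counit x * counit y;
  antipode_subdef : {linear H -> H};
  antipodel_subproof : forall x : H,
    \tsum_(x1 \ox x2 <- comul x) (antipode_subdef x1 * x2) = (counit x)%:A;
  antipoder_subproof : forall x : H,
    \tsum_(x1 \ox x2 <- comul x) (x1 * antipode_subdef x2) = (counit x)%:A
}.

#[short(type="hopfAlgType")]
HB.structure Definition HopfAlgebra (k : fieldType) :=
  {H of GRing.Algebra k H & Coalgebra k H & isHopfAlgebra k H}.

Section HopfTheory.
Context {k : fieldType} {H : hopfAlgType k}.
Implicit Types x y : H.

Lemma comul1 : comul (1 : H) = 1 \ox 1. Proof. exact: comul1_subproof. Qed.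

Lemma comulM x y : comul (x * y) =
  \tsum_(x1 \ox x2 <- comul x) \tsum_(y1 \ox y2 <- comul y)
    ((x1 * y1) \ox (x2 * y2)).
Proof. exact: comulM_subproof. Qed.

Lemma counit1 : counit (1 : H) = 1. Proof. exact: counit1_subproof. Qed.

Lemma counitM x y : counit (x * y) = counit x * counit y.
Proof. exact: counitM_subproof. Qed.

Definition antipode : {linear H -> H} := antipode_subdef.

Lemma antipodel x :
  \tsum_(x1 \ox x2 <- comul x) (antipode x1 * x2) = (counit x)%:A.
Proof. exact: antipodel_subproof. Qed.

Lemma antipoder x :
  \tsum_(x1 \ox x2 <- comul x) (x1 * antipode x2) = (counit x)%:A.
Proof. exact: antipoder_subproof. Qed.

End HopfTheory.

Section Comodules.
Context {k : fieldType}.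

Definition right_comodule (C : coalgType k) (W : lmodType k)
    (rho : {linear W -> tensor W C}) : Prop :=
  (forall w,
    \tsum_(w0 \ox w1 <- rho w) \tsum_(x \ox y <- rho w0) (x \ox y \ox w1)
    = \tsum_(w0 \ox w1 <- rho w) \tsum_(y \ox z <- comul w1) (w0 \ox y \ox z))
  /\ (forall w, \tsum_(w0 \ox w1 <- rho w) (counit w1 *: w0) = w).

Variables (H : hopfAlgType k) (M : lmodType k).
Local Notation S := (@antipode k H).

(* With [rho m = m0 \ox m1], [rho m0 = m00 \ox m01] and
   [rho m00 = m000 \ox m001] in Sweedler notation. *)
Record right_partial_comodule (rho : {linear M -> tensor M H}) : Prop := {
  partial_counit : forall m, \tsum_(m0 \ox m1 <- rho m) (counit m1 *: m0) = m;
  partial_coactl : forall m,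
    \tsum_(m0 \ox m1 <- rho m) \tsum_(m00 \ox m01 <- rho m0)
      \tsum_(h1 \ox h2 <- comul m01) m00 \ox h1 \ox (h2 * S m1)
    = \tsum_(m0 \ox m1 <- rho m) \tsum_(m00 \ox m01 <- rho m0)
      \tsum_(m000 \ox m001 <- rho m00) m000 \ox m001 \ox (m01 * S m1);
  partial_coactr : forall m,
    \tsum_(m0 \ox m1 <- rho m) \tsum_(m00 \ox m01 <- rho m0)
      \tsum_(h1 \ox h2 <- comul m1) m00 \ox (m01 * S h1) \ox h2
    = \tsum_(m0 \ox m1 <- rho m) \tsum_(m00 \ox m01 <- rho m0)
      \tsum_(m000 \ox m001 <- rho m00) m000 \ox (m001 * S m01) \ox m1
}.

End Comodules.

Section Subspaces.
Local Open Scope classical_set_scope.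
Context {k : fieldType}.
Implicit Types (U V W : lmodType k).

Definition linear_set V (A : set V) : Prop :=
  A 0 /\ forall a x y, A x -> A y -> A (a *: x + y).

(* The subspace of [U \ox V] spanned by the [a \ox b] with [a] in [A] and [b]
   in [B]; for subspaces [A] and [B] this is the image of [A \ox B]. *)
Definition tensor_set U V (A : set U) (B : set V) : set (tensor U V) :=
  [set t | exists2 s : seq (U * V),
    forall p, p \in s -> A p.1 /\ B p.2 & t = \sum_(p <- s) p.1 \ox p.2].

Lemma linear_set_functional V (S : set V) (v : V) :
  linear_set S -> ~ S v ->
  exists phi : {scalar V}, phi v = 1 /\ forall x, S x -> phi x = 0.
Proof.
move=> [S0 SL] Sv.
pose P (A : set V) := A = set0 \/ [/\ linear_set A, S `<=` A & ~ A v].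
have [F FP Ftot|C [CP Cmax]] := @Zorn_bigcup V P.
  have [[X FX /eqP X0]|no] := pselect (exists2 X, F X & X != set0); last first.
    left; apply/seteqP; split => // x [X FX Xx]; apply: no; exists X => //.
    by apply/eqP => X0; rewrite X0 in Xx.
  right; have XP : [/\ linear_set X, S `<=` X & ~ X v] by case: (FP _ FX).
  split.
  - split; first by exists X => //; case: XP => -[].
    move=> a x y [Y FY Yx] [Z FZ Zy].
    have [YZ|ZY] := Ftot _ _ FY FZ.
      exists Z => //; case: (FP _ FZ) => [Z0|[[_ ZL] _ _]]; first by rewrite Z0 in Zy.
      by apply: ZL => //; exact: YZ.
    exists Y => //; case: (FP _ FY) => [Y0|[[_ YL] _ _]]; first by rewrite Y0 in Yx.
    by apply: YL => //; exact: ZY.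
  - by move=> x Sx; exists X => //; case: XP => _ + _; apply.
  - move=> [Y FY Yv]; case: (FP _ FY) => [Y0|[_ _]]; last exact.
    by rewrite Y0 in Yv.
have [C0|[[C0 CL] SC Cv]] := CP.
  exfalso; apply: (Cmax S); last by right; split.
  by rewrite C0; split=> // /(_ _ S0).
have CZ a x : C x -> C (a *: x) by move=> Cx; rewrite -[_ *: _]addr0; exact: CL.
have CD x y : C x -> C y -> C (x + y).
  by move=> Cx Cy; rewrite -[x]scale1r; exact: CL.
have CN x : C x -> C (- x) by move=> Cx; rewrite -scaleN1r; exact: CZ.
have ex x : exists a, C (x - a *: v).
  have [Cx|Cx] := pselect (C x); first by exists 0; rewrite scale0r subr0.
  pose D := [set y | exists b c, C c /\ y = b *: x + c].
  have DP : ~ P D.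
    apply: Cmax; split=> [y Cy|/(_ x) DC].
      by exists 0, y; rewrite scale0r add0r.
    by apply: Cx; apply: DC; exists 1, 0; rewrite scale1r addr0.
  have [[b [c [Cc vE]]]|Dv] := pselect (D v); last first.
    case: DP; right; split=> //.
      split; first by exists 0, 0; rewrite scale0r addr0.
      move=> a _ _ [b [c [Cc ->]]] [b' [c' [Cc' ->]]].
      exists (a * b + b'), (a *: c + c'); split; first exact: CL.
      by rewrite scalerDr scalerDl scalerA addrACA.
    by move=> y Sy; exists 0, y; rewrite scale0r add0r; split => //; exact: SC.
  have b0 : b != 0 by apply/eqP => b0; rewrite b0 scale0r add0r in vE; apply: Cv; rewrite vE.
  exists b^-1; rewrite vE scalerDr scalerA mulVf // scale1r opprD addrA subrr add0r.
  exact/CN/CZ.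
have uniq a b x : C (x - a *: v) -> C (x - b *: v) -> a = b.
  move=> Ca Cb; apply/eqP; rewrite -subr_eq0; apply/negP => /negP ab.
  apply: Cv; have := CZ (a - b)^-1 _ (CD _ _ Cb (CN _ Ca)).
  rewrite opprB [X in _ *: X]addrC addrA subrK -scalerBl scalerA mulVf //.
  by rewrite scale1r.
pose phi x := sval (cid (ex x)).
have phiP x : C (x - phi x *: v) by rewrite /phi; case: cid.
have phi_lin : scalar phi.
  move=> a x y; apply: (uniq _ _ (a *: x + y)); first exact: phiP.
  have := CL a _ _ (phiP x) (phiP y).
  by rewrite scalerBr scalerA addrACA -opprD -scalerDl.
pose phiL : {scalar V} := HB.pack phi (GRing.isLinear.Build _ _ _ _ phi phi_lin).
exists phiL; split=> [|x Sx].
  by apply: (uniq _ _ v); [exact: phiP|rewrite scale1r subrr].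
by apply: (uniq _ _ x); [exact: phiP|rewrite scale0r subr0; exact: SC].
Qed.

Definition slice U V (phi : {scalar V}) (t : tensor U V) : U :=
  \tsum_(u \ox v <- t) (phi v *: u).

Lemma slice_bilinear U V (phi : {scalar V}) :
  bilinear_for *:%R *:%R (fun (u : U) v => phi v *: u).
Proof.
split=> [v a u u'|u a v v'] /=; first by rewrite scalerDr !scalerA mulrC.
by rewrite linearP scalerDl scalerA.
Qed.

Fixpoint span_snd U V (s : seq (U * V)) : set V :=
  if s is p :: s' then [set x | exists a y, span_snd s' y /\ x = a *: p.2 + y]
  else [set 0].

Lemma span_snd_linear U V (s : seq (U * V)) : linear_set (span_snd s).
Proof.
elim: s => [|p s [s0 sL]] /=.
  by split=> // a x y -> ->; rewrite scaler0 addr0.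
split; first by exists 0, 0; rewrite scale0r addr0.
move=> a _ _ [b [y [sy ->]]] [c [z [sz ->]]].
exists (a * b + c), (a *: y + z); split; first exact: sL.
by rewrite scalerDr scalerDl scalerA addrACA.
Qed.

Lemma span_snd_mem U V (s : seq (U * V)) p : p \in s -> span_snd s p.2.
Proof.
elim: s => //= q s ih; rewrite inE => /predU1P[->|ps].
  by exists 1, 0; rewrite scale1r addr0; split=> //; case: (span_snd_linear s).
by exists 0, p.2; rewrite scale0r add0r; split=> //; exact: ih.
Qed.

Lemma span_snd_absorb U V (s : seq (U * V)) u v : span_snd s v ->
  exists2 s', size s' = size s &
    u \ox v + \sum_(p <- s) p.1 \ox p.2 = \sum_(p <- s') p.1 \ox p.2.
Proof.
elim: s v => [|[u1 v1] s ih] v /=.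
  by move=> ->; exists [::]; rewrite // !big_nil linear0r addr0.
move=> [a [y [/ih[s' <- sE] ->]]]; exists ((a *: u + u1, v1) :: s') => //.
by rewrite !big_cons /= -sE linearDr linearDl linearZl linearZr /= addrACA.
Qed.

Lemma tensor_set_slice U V (A : set U) (t : tensor U V) : linear_set A ->
  (forall phi : {scalar V}, A (slice phi t)) -> tensor_set A setT t.
Proof.
move=> [A0 AL]; rewrite [X in tensor_set _ _ X]tensor_sum.
have : t = \sum_(p <- repr t) p.1 \ox p.2 by exact: tensor_sum.
move: (repr t) => s; have [n] := ubnP (size s).
elim: n => // n ih in s t *; case: s => [|[u v] s] /= sn tE tA.
  by rewrite big_nil; exists [::] => //; rewrite big_nil.
have [sv|sv] := pselect (span_snd s v).
  have [s' s's sE] := span_snd_absorb u sv.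
  by rewrite big_cons sE; apply: (ih _ t); rewrite ?s's // -sE tE big_cons.
have [phi [phiv phi0]] := linear_set_functional (span_snd_linear s) sv.
have Au : A u.
  have := tA phi.
  rewrite tE -(tclass_sum ((u, v) :: s)) /slice tlift_class; last exact: slice_bilinear.
  rewrite big_cons /= phiv scale1r big1_seq ?addr0 // => p /= ps.
  by rewrite phi0 ?scale0r //; exact: span_snd_mem.
have sA : forall psi : {scalar V}, A (slice psi (\sum_(p <- s) p.1 \ox p.2)).
  move=> psi; have := AL (- psi v) _ _ Au (tA psi).
  rewrite tE /slice -!tclass_sum !tlift_class; try exact: slice_bilinear.
  by rewrite big_cons /= scaleNr addrA addNr add0r.
have [s' s'A s'E] := ih s (\sum_(p <- s) p.1 \ox p.2) sn erefl sA.
exists ((u, v) :: s'); last by rewrite !big_cons s'E.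
by move=> p; rewrite inE => /predU1P[->|/s'A].
Qed.

Lemma slice_tensor_set U V (A : set U) (t : tensor U V) : linear_set A ->
  tensor_set A setT t -> forall phi : {scalar V}, A (slice phi t).
Proof.
move=> [A0 AL] [s sA ->] phi.
rewrite -tclass_sum /slice tlift_class; last exact: slice_bilinear.
elim: s sA => [|p s ih] sA; first by rewrite big_nil.
rewrite big_cons; apply: AL; first by apply: (sA p _).1; rewrite mem_head.
by apply: ih => q qs; apply: sA; rewrite inE qs orbT.
Qed.

(* Tensoring with a vector space preserves injectivity. *)
Lemma tensor_mapl_inj U U' V (f : {linear U -> U'}) : injective f ->
  injective (fun t : tensor U V => \tsum_(u \ox v <- t) (f u \ox v)).
Proof.
move=> finj.
have bF : bilinear_for *:%R *:%R (fun (u : U) (v : V) => f u \ox v).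
  by split=> [v a u u'|u a v v'] /=; rewrite ?linearP ?(linearPl, linearPr).
have lF := tlift_is_linear bF.
have F0 (d : tensor U V) : \tsum_(u \ox v <- d) (f u \ox v) = 0 -> d = 0.
  move=> dE; have [|phi|s sA ->] := @tensor_set_slice _ _ [set 0] d.
  - by split=> // a x y -> ->; rewrite scaler0 addr0.
  - apply: finj; rewrite linear0 /slice linear_tlift; last exact: linearP.
    have := congr1 (slice phi) dE.
    rewrite /slice linear_tlift; last exact/tlift_is_linear/slice_bilinear.
    rewrite (linear_zero (tlift_is_linear (slice_bilinear _ phi))) => <-.
    apply: eq_tlift => u v; rewrite tlift_pure ?linearZ //.
    exact: slice_bilinear.
  - by rewrite big1_seq // => p /= /sA[-> _]; rewrite linear0l.
move=> t t' tt'; apply/eqP; rewrite -subr_eq0; apply/eqP/F0.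
by rewrite addrC; have := lF (-1) t' t; rewrite !scaleN1r => ->; rewrite -tt' addNr.
Qed.

End Subspaces.

Section Linearity.
Context {k : fieldType}.
Implicit Types (U V W X Y Z : lmodType k).

Lemma tlift_linear_arg U V X Y (F : U -> V -> X) (t : {linear Y -> tensor U V}) :
  bilinear_for *:%R *:%R F -> linear (fun y => tlift F (t y)).
Proof.
by move=> bF a x y; rewrite linearP; exact: tlift_is_linear.
Qed.

Lemma tlift_tlift U V X Y Z (F : X -> Y -> Z) (G : U -> V -> tensor X Y) t :
  bilinear_for *:%R *:%R F ->
  tlift F (tlift G t) = \tsum_(u \ox v <- t) tlift F (G u v).
Proof. by move=> bF; apply: linear_tlift; exact: tlift_is_linear. Qed.

Lemma tpure_map_bilinear U V X Y (f : {linear U -> X}) (g : {linear V -> Y}) :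
  bilinear_for *:%R *:%R (fun u v => f u \ox g v).
Proof.
by split=> [v a u u'|u a v v'] /=; rewrite linearP ?linearPl ?linearPr.
Qed.

Lemma equalizer_submod V X (f g : V -> X) : linear f -> linear g ->
  GRing.subsemimod_closed (fun t => `[< f t = g t >] : bool).
Proof.
move=> lf lg; have f0 := linear_zero lf; have g0 := linear_zero lg.
split; first split.
- by apply/asboolP; rewrite f0 g0.
- move=> x y /asboolP xE /asboolP yE; apply/asboolP.
  by have := lf 1 x y; have := lg 1 x y; rewrite !scale1r xE yE => -> ->.
- move=> a x /asboolP xE; apply/asboolP.
  by have := lf a x 0; have := lg a x 0; rewrite f0 g0 !addr0 xE => -> ->.
Qed.

End Linearity.

Section SubcentralIdempotents.
Local Open Scope classical_set_scope.
Context {k : fieldType} {H : hopfAlgType k}.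
Implicit Types (e : H).

Definition subcentral_idempotent e : Prop :=
  [/\ e != 0, e * e = e &
    \tsum_(e1 \ox e2 <- comul e) (e * e1) \ox e2
    = \tsum_(e1 \ox e2 <- comul e) (e1 * e) \ox e2].

Record right_coideal_subalgebra (A : set H) : Prop := {
  rcs_linear : linear_set A;
  rcs1 : A 1;
  rcsM : forall x y, A x -> A y -> A (x * y);
  rcs_comul : forall x, A x -> tensor_set A setT (comul x)
}.

Definition coideal_gen e : set H := smallest right_coideal_subalgebra [set e].

Lemma coideal_gen_rcs e : right_coideal_subalgebra (coideal_gen e).
Proof.
have L : linear_set (coideal_gen e).
  split; first by move=> A [/rcs_linear[]].
  by move=> a x y Ax Ay B PB; apply: (rcs_linear PB.1).2; [exact: Ax|exact: Ay].
split=> // [A [/rcs1]//|x y Ax Ay A PA|x Ax].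
  by apply: (rcsM PA.1); [exact: Ax|exact: Ay].
apply: tensor_set_slice => // phi A PA.
apply: slice_tensor_set; first exact: rcs_linear PA.1.
by apply: (rcs_comul PA.1); exact: Ax.
Qed.

Definition coideal_gen_plus e : set H :=
  coideal_gen e `&` [set x | counit x = 0].

(* [H * coideal_gen_plus e] *)
Definition hbar_ideal e : {pred H} := fun x =>
  `[< exists2 s : seq (H * H), forall p, p \in s -> coideal_gen_plus e p.2
      & x = \sum_(p <- s) p.1 * p.2 >].

Lemma hbar_ideal_submod e : GRing.subsemimod_closed (hbar_ideal e).
Proof.
split; first split.
- by apply/asboolP; exists [::]; rewrite ?big_nil.
- move=> x y /asboolP[s sA ->] /asboolP[t tA ->]; apply/asboolP.
  exists (s ++ t); last by rewrite big_cat.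
  by move=> p; rewrite mem_cat => /orP[/sA|/tA].
- move=> a x /asboolP[s sA ->]; apply/asboolP.
  exists [seq (a *: p.1, p.2) | p <- s]; first by move=> _ /mapP[p /sA ? ->].
  by rewrite big_map scaler_sumr; apply: eq_bigr => p _; rewrite scalerAl.
Qed.

HB.instance Definition _ e :=
  GRing.isSubmodClosed.Build k H (hbar_ideal e) (hbar_ideal_submod e).

(* The quotient coalgebra [H / H A^+] for [A := coideal_gen e]. *)
Definition hbar e := Quotient.quot (hbar_ideal e).

HB.instance Definition _ e := GRing.Zmodule.on (hbar e).

Definition hbar_proj e (x : H) : hbar e := \pi_(hbar e) x.

Lemma hbar_projP e x y :
  hbar_proj e x = hbar_proj e y <-> x - y \in hbar_ideal e.
Proof. by rewrite Quotient.idealrBE; split=> /eqP. Qed.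

Lemma hbar_proj_repr e (x : hbar e) : hbar_proj e (repr x) = x.
Proof. exact: reprK. Qed.

Lemma hbar_projD e x y :
  hbar_proj e (x + y) = hbar_proj e x + hbar_proj e y.
Proof. by rewrite /hbar_proj piE. Qed.

Definition hbar_scale e (a : k) (x : hbar e) : hbar e :=
  hbar_proj e (a *: repr x).

Lemma hbar_projZ e a x :
  hbar_proj e (a *: x) = hbar_scale a (hbar_proj e x).
Proof.
apply/hbar_projP; rewrite -scalerBr; apply: rpredZ.
by apply/hbar_projP; rewrite hbar_proj_repr.
Qed.

Lemma hbar_scaleA e a b (x : hbar e) :
  hbar_scale a (hbar_scale b x) = hbar_scale (a * b) x.
Proof. by rewrite -[x]hbar_proj_repr -!hbar_projZ scalerA. Qed.

Lemma hbar_scale1 e : left_id 1 (@hbar_scale e).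
Proof. by move=> x; rewrite -[x]hbar_proj_repr -!hbar_projZ scale1r. Qed.

Lemma hbar_scaleDr e : right_distributive (@hbar_scale e) +%R.
Proof.
move=> a x y; rewrite -[x]hbar_proj_repr -[y]hbar_proj_repr.
by rewrite -hbar_projD -!hbar_projZ scalerDr hbar_projD.
Qed.

Lemma hbar_scaleDl e (x : hbar e) : {morph (@hbar_scale e)^~ x : a b / a + b}.
Proof.
move=> a b /=; rewrite -[x]hbar_proj_repr -!hbar_projZ.
by rewrite scalerDl hbar_projD.
Qed.

HB.instance Definition _ e := GRing.Zmodule_isLmodule.Build k (hbar e)
  (@hbar_scaleA e) (@hbar_scale1 e) (@hbar_scaleDr e) (@hbar_scaleDl e).

Lemma hbar_proj_is_linear e : linear (hbar_proj e).
Proof. by move=> a x y; rewrite hbar_projD hbar_projZ. Qed.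

HB.instance Definition _ e := GRing.isLinear.Build k H (hbar e) _ (hbar_proj e)
  (hbar_proj_is_linear e).

Lemma hbar_linear_repr e (X : lmodType k) (f : {linear H -> X}) :
  (forall h a, coideal_gen_plus e a -> f (h * a) = 0) ->
  forall h, f (repr (hbar_proj e h)) = f h.
Proof.
move=> f0 h; apply/eqP; rewrite -subr_eq0 -linearB; apply/eqP.
have : repr (hbar_proj e h) - h \in hbar_ideal e.
  by apply/hbar_projP; rewrite hbar_proj_repr.
move=> /asboolP[s sA ->]; rewrite linear_sum big1_seq // => p /sA.
exact: f0.
Qed.

Lemma hbar_proj_plus e h a :
  coideal_gen_plus e a -> hbar_proj e (h * a) = 0.
Proof.
move=> Aa; rewrite -(linear0 (hbar_proj e)); apply/hbar_projP; rewrite subr0.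
apply/asboolP; exists [:: (h, a)]; last by rewrite big_seq1.
by move=> p; rewrite inE => /eqP ->.
Qed.

Lemma hbar_proj_coideal e h a : coideal_gen e a ->
  hbar_proj e (h * a) = counit a *: hbar_proj e h.
Proof.
move=> Aa; apply/eqP; rewrite -linearZ -subr_eq0 -linearB.
have -> : h * a - counit a *: h = h * (a - (counit a)%:A).
  by rewrite mulrBr -scalerAr mulr1.
rewrite /= hbar_proj_plus //; split=> /=.
  have [[_ L] A1 _ _] := coideal_gen_rcs e.
  by rewrite addrC -scaleNr; exact: L.
by rewrite linearB linearZ /= counit1 mulr1 subrr.
Qed.

Lemma hbar_comul_plus e h a : coideal_gen_plus e a ->
  \tsum_(x \ox y <- comul (h * a)) (hbar_proj e x \ox hbar_proj e y) = 0.
Proof.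
set pp := fun x y => _; move=> [Aa a0].
have bpp : bilinear_for *:%R *:%R pp by exact: tpure_map_bilinear.
rewrite comulM (tlift_tlift _ _ bpp) [LHS]/tlift big1 // => -[h1 h2] _ /=.
rewrite -/(tlift _ _) -/(tlift _ _) tlift_tlift //.
have -> : \tsum_(y1 \ox y2 <- comul a) tlift pp ((h1 * y1) \ox (h2 * y2))
    = \tsum_(y1 \ox y2 <- comul a) (hbar_proj e (h1 * y1) \ox hbar_proj e (h2 * y2)).
  by apply: eq_tlift => u v; rewrite tlift_pure.
have bl : bilinear_for *:%R *:%R
    (fun y1 y2 => hbar_proj e (h1 * y1) \ox hbar_proj e (h2 * y2)).
  by split=> [v b u u'|u b v v'] /=;
     rewrite mulrDr -scalerAr linearP ?linearPl ?linearPr.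
have [s sA sE] := rcs_comul (coideal_gen_rcs e) Aa.
rewrite sE -tclass_sum tlift_class //.
have -> : \sum_(p <- s) hbar_proj e (h1 * p.1) \ox hbar_proj e (h2 * p.2)
  = hbar_proj e h1 \ox hbar_proj e (h2 * \sum_(p <- s) (counit p.1 *: p.2)).
  rewrite mulr_sumr linear_sum linear_sumr; apply: eq_big_seq => p /sA[Ap _].
  by rewrite hbar_proj_coideal // linearZl_LR -linearZr /= -scalerAr linearZ.
have <- : a = \sum_(p <- s) (counit p.1 *: p.2).
  rewrite -[LHS]counitl sE -tclass_sum tlift_class //.
  by split=> [v b u u'|u b v v'] /=;
     rewrite ?linearP ?scalerDl ?scalerDr ?scalerA // mulrC.
by rewrite hbar_proj_plus // linear0r.
Qed.

(* Both are independent of the representative: see [hbar_comulE] and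
   [hbar_counitE]. *)
Definition hbar_comul e (x : hbar e) : tensor (hbar e) (hbar e) :=
  \tsum_(h1 \ox h2 <- comul (repr x)) (hbar_proj e h1 \ox hbar_proj e h2).

Definition hbar_counit e (x : hbar e) : k := counit (repr x).

Lemma hbar_comulE e h : hbar_comul (hbar_proj e h) =
  \tsum_(h1 \ox h2 <- comul h) (hbar_proj e h1 \ox hbar_proj e h2).
Proof.
pose f h := \tsum_(h1 \ox h2 <- comul h) (hbar_proj e h1 \ox hbar_proj e h2).
have fl : linear f by apply: tlift_linear_arg; exact: tpure_map_bilinear.
pose fL : {linear H -> tensor (hbar e) (hbar e)} :=
  HB.pack f (GRing.isLinear.Build _ _ _ _ f fl).
by apply: (@hbar_linear_repr e _ fL) => g a; exact: hbar_comul_plus.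
Qed.

Lemma hbar_counitE e h : hbar_counit (hbar_proj e h) = counit h.
Proof.
apply: (@hbar_linear_repr e k^o counit) => g a [_ a0].
by rewrite counitM a0 mulr0.
Qed.

Lemma hbar_comul_is_linear e : linear (@hbar_comul e).
Proof.
move=> a x y; rewrite -[x]hbar_proj_repr -[y]hbar_proj_repr -linearP.
rewrite !hbar_comulE; apply: (@tlift_linear_arg _ _ _ _ _ _ comul).
exact: tpure_map_bilinear.
Qed.

Lemma hbar_counit_is_linear e : scalar (@hbar_counit e).
Proof.
move=> a x y; rewrite -[x]hbar_proj_repr -[y]hbar_proj_repr -linearP.
by rewrite !hbar_counitE linearP.
Qed.

HB.instance Definition _ e := GRing.isLinear.Build k (hbar e)
  (tensor (hbar e) (hbar e)) _ (@hbar_comul e) (@hbar_comul_is_linear e).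
HB.instance Definition _ e := GRing.isLinear.Build k (hbar e) k _
  (@hbar_counit e) (@hbar_counit_is_linear e).

Lemma hbar_comul_lift e (X : lmodType k) (F : hbar e -> hbar e -> X) h :
  bilinear_for *:%R *:%R F ->
  tlift F (hbar_comul (hbar_proj e h)) =
  \tsum_(h1 \ox h2 <- comul h) F (hbar_proj e h1) (hbar_proj e h2).
Proof.
move=> bF; rewrite hbar_comulE tlift_tlift //.
by apply: eq_tlift => u v; rewrite tlift_pure.
Qed.

Lemma hbar_counitl e (x : hbar e) :
  \tsum_(x1 \ox x2 <- hbar_comul x) (hbar_counit x1 *: x2) = x.
Proof.
rewrite -[x]hbar_proj_repr hbar_comul_lift; last first.
  by split=> [v b u u'|u b v v'] /=;
     rewrite ?linearP ?scalerDl ?scalerDr ?scalerA // mulrC.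
under eq_tlift => u v do rewrite hbar_counitE -linearZ.
by rewrite -linear_tlift ?counitl //; exact: linearP.
Qed.

Lemma hbar_counitr e (x : hbar e) :
  \tsum_(x1 \ox x2 <- hbar_comul x) (hbar_counit x2 *: x1) = x.
Proof.
rewrite -[x]hbar_proj_repr hbar_comul_lift; last first.
  by split=> [v b u u'|u b v v'] /=;
     rewrite ?linearP ?scalerDl ?scalerDr ?scalerA // mulrC.
under eq_tlift => u v do rewrite hbar_counitE -linearZ.
by rewrite -linear_tlift ?counitr //; exact: linearP.
Qed.

Lemma hbar_comulA e (x : hbar e) :
  \tsum_(c1 \ox c2 <- hbar_comul x) \tsum_(y \ox z <- hbar_comul c1)
    (y \ox z \ox c2)
  = \tsum_(c1 \ox c2 <- hbar_comul x) \tsum_(y \ox z <- hbar_comul c2)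
    (c1 \ox y \ox z).
Proof.
have purel (c : hbar e) : bilinear_for *:%R *:%R (fun y z : hbar e => y \ox z \ox c).
  by split=> [v b u u'|u b v v'] /=; rewrite ?(linearPl, linearPr).
have purer (c : hbar e) : bilinear_for *:%R *:%R (fun y z : hbar e => c \ox y \ox z).
  by split=> [v b u u'|u b v v'] /=; rewrite ?(linearPl, linearPr).
have pl (c : H) : bilinear_for *:%R *:%R
    (fun y z : H => hbar_proj e y \ox hbar_proj e z \ox hbar_proj e c).
  by split=> [v b u u'|u b v v'] /=; rewrite linearP ?(linearPl, linearPr).
pose P3 (s : tensor H H) (c : H) : tensor (tensor (hbar e) (hbar e)) (hbar e) :=
  \tsum_(y \ox z <- s) (hbar_proj e y \ox hbar_proj e z \ox hbar_proj e c).
have bP3 : bilinear_for *:%R *:%R P3.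
  split=> [c|s]; first exact: tlift_is_linear.
  apply: tlift_linear_fun => u v b c c' /=.
  by rewrite linearP linearPr.
rewrite -[x]hbar_proj_repr !hbar_comul_lift.
- transitivity (tlift P3
    (\tsum_(c1 \ox c2 <- comul (repr x)) \tsum_(y \ox z <- comul c1)
       (y \ox z \ox c2))).
    rewrite (tlift_tlift _ _ bP3); apply: eq_tlift => h1 h2.
    rewrite (tlift_tlift _ _ bP3) hbar_comul_lift //.
    by apply: eq_tlift => y z; rewrite tlift_pure // /P3 tlift_pure.
  rewrite comulA (tlift_tlift _ _ bP3); apply: eq_tlift => h1 h2.
  rewrite (tlift_tlift _ _ bP3) hbar_comul_lift //.
  by apply: eq_tlift => y z; rewrite tlift_pure // /P3 tlift_pure.
- split=> [c|c].
    by apply: tlift_linear_fun => y z b u u'; rewrite !(linearPl, linearPr).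
  exact: (@tlift_linear_arg _ _ _ _ _ _ (@hbar_comul e)).
- split=> [c|c].
    exact: (@tlift_linear_arg _ _ _ _ _ _ (@hbar_comul e)).
  by apply: tlift_linear_fun => y z b u u'; rewrite !(linearPl, linearPr).
Qed.

HB.instance Definition _ e := isCoalgebra.Build k (hbar e)
  (@hbar_comulA e) (@hbar_counitl e) (@hbar_counitr e).

(* The left ideal [H * e]. *)
Definition left_ideal_pred e : {pred H} := fun x => `[< exists h, x = h * e >].

Lemma left_ideal_submod e : GRing.subsemimod_closed (left_ideal_pred e).
Proof.
split; first split.
- by apply/asboolP; exists 0; rewrite mul0r.
- move=> _ _ /asboolP[h ->] /asboolP[h' ->]; apply/asboolP.
  by exists (h + h'); rewrite mulrDl.
- move=> a _ /asboolP[h ->]; apply/asboolP.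
  by exists (a *: h); rewrite scalerAl.
Qed.

HB.instance Definition _ e :=
  GRing.isSubmodClosed.Build k H (left_ideal_pred e) (left_ideal_submod e).

Record left_ideal e := LeftIdeal {
  left_ideal_val : H;
  left_ideal_valP : left_ideal_val \in left_ideal_pred e
}.

HB.instance Definition _ e := [isSub for @left_ideal_val e].
HB.instance Definition _ e := [Choice of left_ideal e by <:].
HB.instance Definition _ e := [SubChoice_isSubLmodule of left_ideal e by <:].

Lemma left_ideal_val_is_linear e : linear (@left_ideal_val e).
Proof. exact: (linearP (val : left_ideal e -> H)). Qed.

HB.instance Definition _ e := GRing.isLinear.Build k (left_ideal e) H _
  (@left_ideal_val e) (@left_ideal_val_is_linear e).

Lemma mulr_left_ideal e h : h * e \in left_ideal_pred e.
Proof. by apply/asboolP; exists h. Qed.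

(* [h * e] as an element of [left_ideal e]. *)
Definition left_ideal_mul e h : left_ideal e := LeftIdeal (mulr_left_ideal e h).

Section Cotensor.
Context {e : H} {W : lmodType k} (rhoW : {linear W -> tensor W (hbar e)}).

(* Both sides are compared in [W \ox hbar e \ox H], which contains
   [W \ox hbar e \ox left_ideal e] as [k] is a field. *)
Definition cotensor_pred : {pred tensor W (left_ideal e)} := fun t =>
  `[< \tsum_(w \ox x <- t) \tsum_(w0 \ox w1 <- rhoW w)
        w0 \ox w1 \ox left_ideal_val x
      = \tsum_(w \ox x <- t) \tsum_(x1 \ox x2 <- comul (left_ideal_val x))
        w \ox hbar_proj e x1 \ox x2 >].

Lemma cotensor_submod : GRing.subsemimod_closed cotensor_pred.
Proof.
have bl : bilinear_for *:%R *:%R (fun w (x : left_ideal e) =>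
    \tsum_(w0 \ox w1 <- rhoW w) (w0 \ox w1 \ox left_ideal_val x)).
  split=> [x|w]; last first.
    apply: tlift_linear_fun => u v a x y /=.
    by rewrite linearPr.
  apply: (@tlift_linear_arg _ _ _ _ _ _ rhoW).
  by split=> [v b u u'|u b v v'] /=; rewrite ?(linearPl, linearPr).
have br : bilinear_for *:%R *:%R (fun (w : W) (x : left_ideal e) =>
    \tsum_(x1 \ox x2 <- comul (left_ideal_val x)) (w \ox hbar_proj e x1 \ox x2)).
  split=> [x|w].
    apply: tlift_linear_fun => u v a x0 y /=.
    by rewrite !linearPl.
  move=> a x y; rewrite /= linearP.
  apply: tlift_is_linear.
  by split=> [v b u u'|u b v v'] /=; rewrite ?linearP ?(linearPl, linearPr).
exact: (equalizer_submod (tlift_is_linear bl) (tlift_is_linear br)).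
Qed.

HB.instance Definition _ := GRing.isSubmodClosed.Build k
  (tensor W (left_ideal e)) cotensor_pred cotensor_submod.

Record cotensor := Cotensor {
  cotensor_val : tensor W (left_ideal e);
  cotensor_valP : cotensor_val \in cotensor_pred
}.

HB.instance Definition _ := [isSub for cotensor_val].
HB.instance Definition _ := [Choice of cotensor by <:].
HB.instance Definition _ := [SubChoice_isSubLmodule of cotensor by <:].

Lemma cotensor_val_is_linear : linear cotensor_val.
Proof. exact: (linearP (val : cotensor -> _)). Qed.

HB.instance Definition _ := GRing.isLinear.Build k cotensor
  (tensor W (left_ideal e)) _ cotensor_val cotensor_val_is_linear.

End Cotensor.
End SubcentralIdempotents.

(* Main.v *)
Require Import Defs.
From HB Require Import structures.
From mathcomp Require Import all_boot all_algebra.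
From mathcomp Require Import boolp.

Set Implicit Arguments.
Unset Strict Implicit.
Unset Printing Implicit Defensive.

Import GRing.Theory.
Local Open Scope ring_scope.

(* The map [w \ox x |-> w \ox x_(1) e \ox x_(2)] makes all of
   [W \ox left_ideal e] a partial comodule, and the cotensor product is a
   subspace stable under it. The counit axiom holds because [x e = x]. For
   [x = h e], subcentrality turns [x_(1) e \ox x_(2)], which is
   [h_(1) e_(1) e \ox h_(2) e_(2)], into [h_(1) e e_(1) \ox h_(2) e_(2)]; then
   [e_(2) S (h_(2) e_(3))] collapses to [S (h_(2))], so that for bilinear [K]
     [K ((x_(1) e)_(1), (x_(1) e)_(2) S (x_(2)))
      = K ((h_(1) e)_(1) e, (h_(1) e)_(2) S (h_(2)))].
   Both remaining axioms follow from this identity. Stability follows from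
   [hbar_proj e (h e_(1)) \ox e_(2) = hbar_proj e h \ox e]. *)

(** * Closure rules for linear and bilinear expressions *)

Section Multilinear.
Context {k : fieldType}.
Implicit Types (U V W X Y : lmodType k).

Lemma bilinear_ofP U V X (F : U -> V -> X) :
  (forall v, linear (fun u => F u v)) -> (forall u, linear (fun v => F u v)) ->
  bilinear_for *:%R *:%R F.
Proof. by move=> Fl Fr; split=> [v|u] a x y; [exact: Fl|exact: Fr]. Qed.

Lemma linear_comp X Y U (f : {linear Y -> U}) (g : X -> Y) :
  linear g -> linear (fun x => f (g x)).
Proof. by move=> lg a x y; rewrite lg linearP. Qed.

Lemma linear_tlift_arg U V X Y (F : U -> V -> X) (t : Y -> tensor U V) :
  bilinear_for *:%R *:%R F -> linear t -> linear (fun y => tlift F (t y)).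
Proof. by move=> bF lt a x y; rewrite lt; exact: tlift_is_linear. Qed.

Lemma linear_pure_l X U V (f : X -> U) (v : V) :
  linear f -> linear (fun x => f x \ox v).
Proof. by move=> lf a x y; rewrite lf linearPl. Qed.

Lemma linear_pure_r X U V (f : X -> V) (u : U) :
  linear f -> linear (fun x => u \ox f x).
Proof. by move=> lf a x y; rewrite lf linearPr. Qed.

Lemma linear_mul_l X (A : algType k) (f : X -> A) (b : A) :
  linear f -> linear (fun x => f x * b).
Proof. by move=> lf a x y; rewrite lf mulrDl scalerAl. Qed.

Lemma linear_mul_r X (A : algType k) (f : X -> A) (b : A) :
  linear f -> linear (fun x => b * f x).
Proof. by move=> lf a x y; rewrite lf mulrDr scalerAr. Qed.

Lemma linear_scale_l X Y U (phi : {scalar Y}) (f : X -> Y) (u : U) :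
  linear f -> linear (fun x => phi (f x) *: u).
Proof. by move=> lf a x y; rewrite lf linearP scalerDl scalerA. Qed.

Lemma linear_scale_r X U c (f : X -> U) :
  linear f -> linear (fun x => c *: f x).
Proof. by move=> lf a x y; rewrite lf scalerDr !scalerA mulrC. Qed.

Lemma bilinear_comp_l X U V Y (F : U -> V -> Y) (f : X -> U) v :
  bilinear_for *:%R *:%R F -> linear f -> linear (fun x => F (f x) v).
Proof. by move=> [Fl _] lf a x y; rewrite lf; exact: Fl. Qed.

Lemma bilinear_comp_r X U V Y (F : U -> V -> Y) (f : X -> V) u :
  bilinear_for *:%R *:%R F -> linear f -> linear (fun x => F u (f x)).
Proof. by move=> [_ Fr] lf a x y; rewrite lf; exact: Fr. Qed.

End Multilinear.

Lemma left_ideal_mul_is_linear (k : fieldType) (H : hopfAlgType k) (e : H) :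
  linear (left_ideal_mul e).
Proof. by move=> a x y; apply: val_inj; rewrite /= mulrDl scalerAl. Qed.

HB.instance Definition _ (k : fieldType) (H : hopfAlgType k) (e : H) :=
  GRing.isLinear.Build k H (left_ideal e) _ (left_ideal_mul e)
    (left_ideal_mul_is_linear e).

(** The rules for [tlift] require bilinear or linear arguments, so most rewriting steps below leave
    a side goal of this kind. The tactic splits bilinearity into two linearity goals and then
    descends along the syntax of the expression. *)
Ltac multilin :=
  try match goal with |- linear ?f => change (linear (fun x => f x)) end;
  cbv beta;
  (* [solve_constraints] makes a branch fail inside [first] when the bound
     variable occurs in the argument that was assumed constant. *)
  lazymatch goal with
  | |- bilinear_for _ _ _ => refine (bilinear_ofP _ _) => ?; multilin
  | |- linear (fun x => x) => by []
  | |- linear (fun x => tlift _ _) =>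
      first [ refine (@linear_tlift_arg _ _ _ _ _ _ _ _ _); solve_constraints
            | refine (@tlift_linear_fun _ _ _ _ _ _ _ _) => ? ?];
      multilin
  | |- linear (fun x => tpure _ _) =>
      first [ refine (linear_pure_r _ _); solve_constraints
            | refine (linear_pure_l _ _)];
      multilin
  | |- linear (fun x => _ * _) =>
      first [ refine (linear_mul_r _ _); solve_constraints
            | refine (linear_mul_l _ _)];
      multilin
  | |- linear (fun x => _ *: _) =>
      first [ refine (linear_scale_r _ _); solve_constraints
            | refine (linear_scale_l _ _ _)];
      multilin
  | |- linear (fun x => GRing.Linear.sort _ _) =>
      refine (linear_comp _ _); multilin
  | bF : bilinear_for _ _ ?F |- linear (fun x => ?F _ _) =>
      first [ refine (bilinear_comp_r _ bF _); solve_constraints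
            | refine (bilinear_comp_l _ bF _)];
      multilin
  | |- linear (fun x => hbar_proj ?e (@?f x)) =>
      refine (linear_comp (hbar_proj e) _); multilin
  | |- linear (fun x => left_ideal_val (@?f x)) =>
      refine (linear_comp (@left_ideal_val _ _ _) _); multilin
  | |- linear (fun x => left_ideal_mul ?e (@?f x)) =>
      refine (linear_comp (left_ideal_mul e) _); multilin
  | |- _ => try done
  end.

(** * Sweedler calculus and the identities for a subcentral idempotent *)

Section Sweedler.
Context {k : fieldType}.

Lemma eq_linear_pure (U V X : lmodType k) (f g : tensor U V -> X) :
  linear f -> linear g -> (forall u v, f (u \ox v) = g (u \ox v)) -> f =1 g.
Proof.
move=> lf lg fg t; rewrite -[t]tlift_id (linear_tlift _ _ lf).
by rewrite (linear_tlift _ _ lg); apply: eq_tlift => u v; exact: fg.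
Qed.

(** Valid for arbitrary [F], since [tlift] is by definition a finite sum over a chosen
    representative of the tensor. *)
Lemma exchange_tlift (U V U' V' X : lmodType k)
    (F : U -> V -> U' -> V' -> X) s t :
  \tsum_(u \ox v <- s) \tsum_(u' \ox v' <- t) F u v u' v' =
  \tsum_(u' \ox v' <- t) \tsum_(u \ox v <- s) F u v u' v'.
Proof. exact: exchange_big. Qed.

Lemma tlift_comulA (C : coalgType k) (X : lmodType k) (F : C -> C -> C -> X) c :
  (forall z, bilinear_for *:%R *:%R (fun x y => F x y z)) ->
  (forall x y, linear (F x y)) ->
  \tsum_(c1 \ox c2 <- comul c) \tsum_(x \ox y <- comul c1) F x y c2 =
  \tsum_(c1 \ox c2 <- comul c) \tsum_(y \ox z <- comul c2) F c1 y z.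
Proof.
move=> Fl Fr.
(* Triple tensors are bracketed to the left, so [tlift G] is the linear extension of [F] to
   [C \ox C \ox C]; it is applied to both sides of [comulA]. *)
pose G (s : tensor C C) (z : C) := \tsum_(x \ox y <- s) F x y z.
have bG : bilinear_for *:%R *:%R G.
  apply: bilinear_ofP => [z|s]; first exact: tlift_is_linear.
  by apply: tlift_linear_fun => x y; exact: Fr.
have := congr1 (tlift G) (comulA c); rewrite !(tlift_tlift _ _ bG) => E.
transitivity (\tsum_(c1 \ox c2 <- comul c)
    tlift G (\tsum_(x \ox y <- comul c1) (x \ox y \ox c2))).
  apply: eq_tlift => c1 c2; rewrite (tlift_tlift _ _ bG).
  by apply: eq_tlift => x y; rewrite tlift_pure // /G tlift_pure.
rewrite E; apply: eq_tlift => c1 c2; rewrite (tlift_tlift _ _ bG).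
by apply: eq_tlift => x y; rewrite tlift_pure // /G tlift_pure.
Qed.

Context {H : hopfAlgType k}.
Implicit Types (x y e : H) (X : lmodType k).
Local Notation S := (@antipode k H).

Lemma tlift_comulM X (F : H -> H -> X) x y : bilinear_for *:%R *:%R F ->
  \tsum_(h1 \ox h2 <- comul (x * y)) F h1 h2 =
  \tsum_(x1 \ox x2 <- comul x) \tsum_(y1 \ox y2 <- comul y)
    F (x1 * y1) (x2 * y2).
Proof.
move=> bF; rewrite comulM (tlift_tlift _ _ bF); apply: eq_tlift => x1 x2.
rewrite (tlift_tlift _ _ bF); apply: eq_tlift => y1 y2.
by rewrite tlift_pure.
Qed.

Lemma tlift_counitl X (f : H -> X) x : linear f ->
  \tsum_(x1 \ox x2 <- comul x) (counit x1 *: f x2) = f x.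
Proof.
move=> lf; rewrite -[in RHS](counitl x) (linear_tlift _ _ lf).
apply: eq_tlift => x1 x2.
by have := lf (counit x1) x2 0; rewrite (linear_zero lf) !addr0.
Qed.

Lemma tlift_counitr X (f : H -> X) x : linear f ->
  \tsum_(x1 \ox x2 <- comul x) (counit x2 *: f x1) = f x.
Proof.
move=> lf; rewrite -[in RHS](counitr x) (linear_tlift _ _ lf).
apply: eq_tlift => x1 x2.
by have := lf (counit x2) x1 0; rewrite (linear_zero lf) !addr0.
Qed.

(* Replacing [S(y x2)] by [S(y1) y2 S(y3 x2)] turns the sum
   into [S(y1) (y2 x)_1 S((y2 x)_2)], so anti-multiplicativity of [S] is not
   needed. *)
Lemma antipode_mul_absorb x y :
  \tsum_(x1 \ox x2 <- comul x) (x1 * S (y * x2)) = counit x *: S y.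
Proof.
transitivity (\tsum_(x1 \ox x2 <- comul x) \tsum_(a \ox b <- comul y)
   \tsum_(c \ox d <- comul a) (S c * d * (x1 * S (b * x2)))).
  apply: eq_tlift => x1 x2.
  rewrite -(@tlift_counitl _ (fun y => x1 * S (y * x2)) y); last by multilin.
  apply: eq_tlift => a b.
  rewrite -[RHS](@linear_tlift _ _ _ _ _ (fun z => z * (x1 * S (b * x2))));
    last by multilin.
  by rewrite antipodel -scalerAl mul1r.
rewrite exchange_tlift.
transitivity (\tsum_(a \ox b <- comul y) \tsum_(c \ox d <- comul a)
  \tsum_(x1 \ox x2 <- comul x) (S c * d * (x1 * S (b * x2)))).
  by apply: eq_tlift => a b; rewrite exchange_tlift.
rewrite (@tlift_comulA _ _ (fun c d b =>
  \tsum_(x1 \ox x2 <- comul x) (S c * d * (x1 * S (b * x2))))); first last.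
- by move=> c d; multilin.
- by move=> b; multilin.
transitivity (\tsum_(c \ox b <- comul y) (S c * (counit (b * x))%:A)).
  apply: eq_tlift => c b; rewrite -antipoder.
  rewrite (@tlift_comulM _ (fun h1 h2 => h1 * S h2)); last by multilin.
  rewrite (@linear_tlift _ _ _ _ _ (fun z => S c * z)); last by multilin.
  apply: eq_tlift => b1 b2.
  rewrite (@linear_tlift _ _ _ _ _ (fun z => S c * z)); last by multilin.
  by apply: eq_tlift => x1 x2; rewrite !mulrA.
rewrite -(@tlift_counitr _ (fun z => counit x *: S z)); last by multilin.
by apply: eq_tlift => c b; rewrite -scalerAr mulr1 scalerA counitM.
Qed.

Lemma tlift_subcentral X (F : H -> H -> X) e :
  subcentral_idempotent e -> bilinear_for *:%R *:%R F ->
  \tsum_(e1 \ox e2 <- comul e) F (e1 * e) e2 =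
  \tsum_(e1 \ox e2 <- comul e) F (e * e1) e2.
Proof.
move=> [_ _ E] bF; have := congr1 (tlift F) E.
rewrite !(tlift_tlift _ _ bF).
under eq_tlift => u v do rewrite tlift_pure //.
by under [in RHS]eq_tlift => u v do rewrite tlift_pure //.
Qed.

Lemma tlift_antipode_ideal X (K : H -> H -> X) e h :
  subcentral_idempotent e -> bilinear_for *:%R *:%R K ->
  \tsum_(x1 \ox x2 <- comul (h * e)) \tsum_(u1 \ox u2 <- comul (x1 * e))
    K u1 (u2 * S x2) =
  \tsum_(h1 \ox h2 <- comul h) \tsum_(u1 \ox u2 <- comul (h1 * e))
    K (u1 * e) (u2 * S h2).
Proof.
move=> se bK.
rewrite (@tlift_comulM _ (fun x1 x2 =>
  \tsum_(u1 \ox u2 <- comul (x1 * e)) K u1 (u2 * S x2))); last by multilin.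
apply: eq_tlift => h1 h2.
(* Subcentrality needs the trailing [e] directly after [f1]; it then moves [e] to the left of [f1],
   next to [h1]. *)
under eq_tlift => f1 f2 do rewrite -mulrA.
rewrite (@tlift_subcentral _ (fun f1 f2 =>
  \tsum_(u1 \ox u2 <- comul (h1 * f1)) K u1 (u2 * S (h2 * f2)))) //;
  last by multilin.
under eq_tlift => f1 f2 do rewrite mulrA.
transitivity (\tsum_(f1 \ox f2 <- comul e) \tsum_(a1 \ox a2 <- comul (h1 * e))
  \tsum_(g1 \ox g2 <- comul f1) K (a1 * g1) (a2 * g2 * S (h2 * f2))).
  apply: eq_tlift => f1 f2.
  rewrite (@tlift_comulM _ (fun u1 u2 => K u1 (u2 * S (h2 * f2)))) //.
  by multilin.
rewrite exchange_tlift; apply: eq_tlift => a1 a2.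
(* Coassociativity regroups the three legs of [e], so that the last two meet in [g1 * S (h2 * g2)],
   the shape treated by [antipode_mul_absorb]. *)
rewrite (@tlift_comulA _ _ (fun f1 g1 g2 =>
  K (a1 * f1) (a2 * g1 * S (h2 * g2)))); first last.
- by move=> x y; multilin.
- by move=> z; multilin.
(* The right-hand side is expanded by the counit to match the factor [counit f2] that the absorption
   produces. *)
rewrite -(@tlift_counitr _ (fun f1 => K (a1 * f1) (a2 * S h2)) e);
  last by multilin.
apply: eq_tlift => f1 f2.
have lK : linear (fun z => K (a1 * f1) (a2 * z)) by multilin.
transitivity (K (a1 * f1) (a2 * (counit f2 *: S h2))).
  rewrite -antipode_mul_absorb (linear_tlift _ _ lK).
  by apply: eq_tlift => g1 g2; rewrite mulrA.
by have := lK (counit f2) (S h2) 0; rewrite (linear_zero lK) !addr0.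
Qed.

(** As [coideal_gen e] is a right coideal containing [e], the left legs of [comul e] can be taken in
    it. Right multiplication by such elements acts on [hbar e] through the counit, which then
    reassembles [e] from the right legs. *)
Lemma tlift_hbar_proj X e (F : hbar e -> H -> X) h :
  bilinear_for *:%R *:%R F ->
  \tsum_(e1 \ox e2 <- comul e) F (hbar_proj e (h * e1)) e2 =
  F (hbar_proj e h) e.
Proof.
move=> bF; have Ae : coideal_gen e e by move=> A [_]; exact.
have [s sA sE] := rcs_comul (coideal_gen_rcs e) Ae.
rewrite -[RHS](@tlift_counitl _ (F (hbar_proj e h))); last by multilin.
rewrite sE -tclass_sum !tlift_class; try by multilin.
apply: eq_big_seq => p /sA[Ap _]; rewrite hbar_proj_coideal //.
have Fl := bF.1 p.2; have := Fl (counit p.1) (hbar_proj e h) 0.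
by rewrite /= (linear_zero Fl) !addr0.
Qed.

End Sweedler.

(** * Descent of the partial comodule axioms along an injective colinear map *)

Section PartialSubcomodule.
Context {k : fieldType} {H : hopfAlgType k} {M N : lmodType k}.
Context {i : {linear M -> N}} {rhoM : {linear M -> tensor M H}}.
Context {rhoN : {linear N -> tensor N H}}.
Hypothesis i_inj : injective i.
Hypothesis i_colinear : forall m,
  \tsum_(y \ox h <- rhoM m) (i y \ox h) = rhoN (i m).
Implicit Types (X : lmodType k).
Local Notation S := (@antipode k H).

Lemma tlift_colinear X (F : N -> H -> X) m : bilinear_for *:%R *:%R F ->
  \tsum_(y \ox h <- rhoM m) F (i y) h = tlift F (rhoN (i m)).
Proof.
move=> bF; rewrite -i_colinear (tlift_tlift _ _ bF).
by apply: eq_tlift => y h; rewrite tlift_pure.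
Qed.

Lemma tlift_colinear2 X (F : N -> H -> H -> X) m :
  (forall h, bilinear_for *:%R *:%R (fun n g => F n g h)) ->
  (forall n g, linear (F n g)) ->
  \tsum_(m0 \ox m1 <- rhoM m) \tsum_(m00 \ox m01 <- rhoM m0)
    F (i m00) m01 m1 =
  \tsum_(n0 \ox n1 <- rhoN (i m)) \tsum_(n00 \ox n01 <- rhoN n0)
    F n00 n01 n1.
Proof.
move=> Fl Fr; rewrite -(@tlift_colinear _ (fun n0 n1 =>
  \tsum_(n00 \ox n01 <- rhoN n0) F n00 n01 n1)); last first.
  apply: bilinear_ofP => [h|n]; first exact: tlift_linear_arg (Fl h).
  by apply: tlift_linear_fun => n00 n01; exact: Fr.
apply: eq_tlift => m0 m1.
by rewrite (@tlift_colinear _ (fun n g => F n g m1)).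
Qed.

(** This is [i] tensored with two identities; both coaction axioms are equations in its domain and
    are compared after applying it. *)
Let val2 (t : tensor (tensor M H) H) : tensor (tensor N H) H :=
  \tsum_(s \ox g <- t) (\tsum_(m \ox h <- s) (i m \ox h)) \ox g.

Let val2_linear : linear val2.
Proof. by rewrite /val2; multilin. Qed.

(** Tensoring over a field preserves injectivity; this is used once for each factor [H]. *)
Let val2_inj : injective val2.
Proof.
pose f (s : tensor M H) := \tsum_(m \ox h <- s) (i m \ox h).
have lf : linear f by rewrite /f; multilin.
pose fL : {linear tensor M H -> tensor N H} :=
  HB.pack f (GRing.isLinear.Build _ _ _ _ f lf).
by apply: (tensor_mapl_inj (f := fL)); exact: tensor_mapl_inj.
Qed.

Let val2_pure m h g : val2 (m \ox h \ox g) = i m \ox h \ox g.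
Proof. by rewrite /val2 !tlift_pure //; multilin. Qed.

Let val2_tlift (U V : lmodType k) (F : U -> V -> tensor (tensor M H) H) t :
  val2 (tlift F t) = \tsum_(u \ox v <- t) val2 (F u v).
Proof. exact: linear_tlift val2_linear. Qed.

(** Each axiom is tested after the injection [i] or [val2], where colinearity exchanges the coaction
    of [M] for that of [N], one level of iteration at a time. *)
Lemma right_partial_comodule_sub :
  right_partial_comodule rhoN -> right_partial_comodule rhoM.
Proof.
move=> [counitN coactlN coactrN]; split=> m.
- apply: i_inj; rewrite linear_tlift; last exact: linearP.
  under eq_tlift => m0 m1 do rewrite linearZ.
  rewrite (@tlift_colinear _ (fun n h => counit h *: n)) ?counitN //.
  by multilin.
- apply: val2_inj; rewrite !val2_tlift.
  transitivity (\tsum_(m0 \ox m1 <- rhoM m) \tsum_(m00 \ox m01 <- rhoM m0)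
      \tsum_(h1 \ox h2 <- comul m01) i m00 \ox h1 \ox (h2 * S m1)).
    apply: eq_tlift => m0 m1; rewrite val2_tlift; apply: eq_tlift => m00 m01.
    by rewrite val2_tlift; apply: eq_tlift => h1 h2; rewrite val2_pure.
  rewrite (@tlift_colinear2 _ (fun n g h =>
    \tsum_(h1 \ox h2 <- comul g) n \ox h1 \ox (h2 * S h))); first last.
  + by move=> n g; multilin.
  + by move=> h; multilin.
  (* This side iterates the coaction three times: the two outer ones are pulled back to [M] here,
     the innermost one after the sums have been matched. *)
  rewrite coactlN -(@tlift_colinear2 _ (fun n g h =>
    \tsum_(n0 \ox n1 <- rhoN n) n0 \ox n1 \ox (g * S h))); first last.
  + by move=> n g; multilin.
  + by move=> h; multilin.
  apply: eq_tlift => m0 m1; rewrite val2_tlift; apply: eq_tlift => m00 m01.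
  rewrite -(@tlift_colinear _ (fun n h => n \ox h \ox (m01 * S m1)));
    last by multilin.
  by rewrite val2_tlift; apply: eq_tlift => h1 h2; rewrite val2_pure.
- apply: val2_inj; rewrite !val2_tlift.
  transitivity (\tsum_(m0 \ox m1 <- rhoM m) \tsum_(m00 \ox m01 <- rhoM m0)
      \tsum_(h1 \ox h2 <- comul m1) i m00 \ox (m01 * S h1) \ox h2).
    apply: eq_tlift => m0 m1; rewrite val2_tlift; apply: eq_tlift => m00 m01.
    by rewrite val2_tlift; apply: eq_tlift => h1 h2; rewrite val2_pure.
  rewrite (@tlift_colinear2 _ (fun n g h =>
    \tsum_(h1 \ox h2 <- comul h) n \ox (g * S h1) \ox h2)); first last.
  + by move=> n g; multilin.
  + by move=> h; multilin.
  rewrite coactrN -(@tlift_colinear2 _ (fun n g h =>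
    \tsum_(n0 \ox n1 <- rhoN n) n0 \ox (n1 * S g) \ox h)); first last.
  + by move=> n g; multilin.
  + by move=> h; multilin.
  apply: eq_tlift => m0 m1; rewrite val2_tlift; apply: eq_tlift => m00 m01.
  rewrite -(@tlift_colinear _ (fun n h => n \ox (h * S m01) \ox m1));
    last by multilin.
  by rewrite val2_tlift; apply: eq_tlift => h1 h2; rewrite val2_pure.
Qed.

End PartialSubcomodule.

(** * The partial coaction on the whole of [W \ox left_ideal e] *)

Section LeftIdealCoaction.
Context {k : fieldType} {H : hopfAlgType k} {e : H} {W : lmodType k}.
Implicit Types (X : lmodType k).
Local Notation S := (@antipode k H).

Definition ideal_coact (t : tensor W (left_ideal e)) :
    tensor (tensor W (left_ideal e)) H :=
  \tsum_(w \ox x <- t) \tsum_(x1 \ox x2 <- comul (left_ideal_val x))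
    (w \ox left_ideal_mul e x1 \ox x2).

Lemma ideal_coact_is_linear : linear ideal_coact.
Proof. by rewrite /ideal_coact; multilin. Qed.

HB.instance Definition _ := GRing.isLinear.Build k (tensor W (left_ideal e))
  (tensor (tensor W (left_ideal e)) H) _ ideal_coact ideal_coact_is_linear.

Lemma tlift_ideal_coact X (F : tensor W (left_ideal e) -> H -> X) t :
  bilinear_for *:%R *:%R F ->
  tlift F (ideal_coact t) =
  \tsum_(w \ox x <- t) \tsum_(x1 \ox x2 <- comul (left_ideal_val x))
    F (w \ox left_ideal_mul e x1) x2.
Proof.
move=> bF; rewrite (tlift_tlift _ _ bF); apply: eq_tlift => w x.
by rewrite (tlift_tlift _ _ bF); apply: eq_tlift => x1 x2; rewrite tlift_pure.
Qed.

Lemma tlift_ideal_coact_pure X (F : tensor W (left_ideal e) -> H -> X) w x :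
  bilinear_for *:%R *:%R F ->
  tlift F (ideal_coact (w \ox x)) =
  \tsum_(x1 \ox x2 <- comul (left_ideal_val x))
    F (w \ox left_ideal_mul e x1) x2.
Proof. by move=> bF; rewrite tlift_ideal_coact // tlift_pure //; multilin. Qed.

Hypothesis e_sub : subcentral_idempotent e.

Let ee : e * e = e.
Proof. by case: e_sub. Qed.

Lemma left_ideal_mulMr h : left_ideal_mul e (h * e) = left_ideal_mul e h.
Proof. by apply: val_inj; rewrite /= -mulrA ee. Qed.

Lemma left_ideal_mulK x : left_ideal_mul e (left_ideal_val x) = x.
Proof.
have /asboolP[h hE] := left_ideal_valP x.
by apply: val_inj; rewrite /= hE -mulrA ee.
Qed.

(** Bundled as a linear map, so that [multilin] recognises its applications. *)
Let rho : {linear tensor W (left_ideal e) -> tensor _ H} := ideal_coact.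

Let tlift_rho_pure X (F : tensor W (left_ideal e) -> H -> X) w x :
  bilinear_for *:%R *:%R F ->
  tlift F (rho (w \ox x)) =
  \tsum_(x1 \ox x2 <- comul (left_ideal_val x))
    F (w \ox left_ideal_mul e x1) x2.
Proof. exact: tlift_ideal_coact_pure. Qed.

(** The first coaction leaves [x1 * e] in the left ideal, so this product is what the second one
    comultiplies. Both coaction axioms start from the resulting double sum. *)
Let rho2_pure X (F : tensor W (left_ideal e) -> H -> H -> X) w x :
  (forall h, bilinear_for *:%R *:%R (fun t g => F t g h)) ->
  (forall t g, linear (F t g)) ->
  \tsum_(t0 \ox t1 <- rho (w \ox x)) \tsum_(t00 \ox t01 <- rho t0)
    F t00 t01 t1 =
  \tsum_(x1 \ox x2 <- comul (left_ideal_val x))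
    \tsum_(u1 \ox u2 <- comul (x1 * e)) F (w \ox left_ideal_mul e u1) u2 x2.
Proof.
move=> Fl Fr.
rewrite (@tlift_rho_pure _ (fun t h => \tsum_(t0 \ox t1 <- rho t) F t0 t1 h)).
  apply: eq_tlift => x1 x2.
  by rewrite (@tlift_rho_pure _ (fun t g => F t g x2)).
apply: bilinear_ofP => [h|t]; first exact: tlift_linear_arg (Fl h).
by apply: tlift_linear_fun => t0 t1; exact: Fr.
Qed.

(** With [K a b] equal to the sum of [w \ox a_(1) e \ox a_(2) \ox b], the two sides are sums of
    [K u1 (u2 * S x2)] and of [K (u1 * e) (u2 * S x2)]. For [x = h e], [tlift_antipode_ideal]
    inserts one more [e] in the first argument of each, and the two agree because [e * e = e]. *)
Lemma ideal_coact_coactl t :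
  \tsum_(t0 \ox t1 <- rho t) \tsum_(t00 \ox t01 <- rho t0)
    \tsum_(h1 \ox h2 <- comul t01) t00 \ox h1 \ox (h2 * S t1)
  = \tsum_(t0 \ox t1 <- rho t) \tsum_(t00 \ox t01 <- rho t0)
    \tsum_(t000 \ox t001 <- rho t00) t000 \ox t001 \ox (t01 * S t1).
Proof.
move: t; apply: eq_linear_pure => [||w x]; try by multilin.
rewrite (@rho2_pure _ (fun t g h =>
  \tsum_(h1 \ox h2 <- comul g) t \ox h1 \ox (h2 * S h))); first last.
- by move=> t g; multilin.
- by move=> h; multilin.
rewrite (@rho2_pure _ (fun t g h =>
  \tsum_(t0 \ox t1 <- rho t) t0 \ox t1 \ox (g * S h))); first last.
- by move=> t g; multilin.
- by move=> h; multilin.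
have /asboolP[h ->] := left_ideal_valP x.
pose K (a b : H) :=
  \tsum_(t1 \ox t2 <- comul a) w \ox left_ideal_mul e t1 \ox t2 \ox b.
have bK : bilinear_for *:%R *:%R K by rewrite /K; multilin.
transitivity (\tsum_(x1 \ox x2 <- comul (h * e))
    \tsum_(u1 \ox u2 <- comul (x1 * e)) K u1 (u2 * S x2)).
  apply: eq_tlift => x1 x2; rewrite /K (@tlift_comulA _ _ _ (fun t1 t2 u =>
    w \ox left_ideal_mul e t1 \ox t2 \ox (u * S x2))) //.
    by move=> u; multilin.
  by move=> t1 t2; multilin.
transitivity (\tsum_(x1 \ox x2 <- comul (h * e))
    \tsum_(u1 \ox u2 <- comul (x1 * e)) K (u1 * e) (u2 * S x2)); last first.
  apply: eq_tlift => x1 x2; apply: eq_tlift => u1 u2.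
  rewrite (@tlift_rho_pure _ (fun t g => t \ox g \ox (u2 * S x2))) //.
  by multilin.
rewrite tlift_antipode_ideal //.
rewrite (@tlift_antipode_ideal _ _ _ (fun a b => K (a * e) b)) //;
  last by multilin.
by apply: eq_tlift => h1 h2; apply: eq_tlift => u1 u2; rewrite -mulrA ee.
Qed.

(** Here [tlift_antipode_ideal] is applied on the right-hand side only, with the leg [x1] as [h];
    the left-hand side reaches the same form by coassociativity. *)
Lemma ideal_coact_coactr t :
  \tsum_(t0 \ox t1 <- rho t) \tsum_(t00 \ox t01 <- rho t0)
    \tsum_(h1 \ox h2 <- comul t1) t00 \ox (t01 * S h1) \ox h2
  = \tsum_(t0 \ox t1 <- rho t) \tsum_(t00 \ox t01 <- rho t0)
    \tsum_(t000 \ox t001 <- rho t00) t000 \ox (t001 * S t01) \ox t1.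
Proof.
move: t; apply: eq_linear_pure => [||w x]; try by multilin.
rewrite (@rho2_pure _ (fun t g h =>
  \tsum_(h1 \ox h2 <- comul h) t \ox (g * S h1) \ox h2)); first last.
- by move=> t g; multilin.
- by move=> h; multilin.
rewrite (@rho2_pure _ (fun t g h =>
  \tsum_(t0 \ox t1 <- rho t) t0 \ox (t1 * S g) \ox h)); first last.
- by move=> t g; multilin.
- by move=> h; multilin.
(* The comultiplication of [x2] has to come directly after that of [x] for coassociativity to
   apply. *)
under eq_tlift => x1 x2 do rewrite exchange_tlift.
rewrite -(@tlift_comulA _ _ _ (fun x1 v1 v2 =>
  \tsum_(u1 \ox u2 <- comul (x1 * e))
    w \ox left_ideal_mul e u1 \ox (u2 * S v1) \ox v2)); first last.
- by move=> x1 v1; multilin.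
- by move=> v2; multilin.
apply: eq_tlift => x1 x2.
transitivity (\tsum_(u1 \ox u2 <- comul (x1 * e))
    \tsum_(t1 \ox t2 <- comul (u1 * e))
      w \ox left_ideal_mul e t1 \ox (t2 * S u2) \ox x2); last first.
  apply: eq_tlift => u1 u2.
  rewrite (@tlift_rho_pure _ (fun t g => t \ox (g * S u2) \ox x2)) //.
  by multilin.
rewrite (@tlift_antipode_ideal _ _ _ (fun a b =>
  w \ox left_ideal_mul e a \ox b \ox x2)) //; last by multilin.
apply: eq_tlift => h1 h2; apply: eq_tlift => u1 u2.
by rewrite left_ideal_mulMr.
Qed.

Lemma ideal_coact_partial : right_partial_comodule rho.
Proof.
split; [|exact: ideal_coact_coactl|exact: ideal_coact_coactr].
apply: eq_linear_pure => [||w x]; try by multilin.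
rewrite (@tlift_rho_pure _ (fun t h => counit h *: t)); last by multilin.
rewrite (@tlift_counitr _ _ _ (fun h => w \ox left_ideal_mul e h));
  last by multilin.
by rewrite left_ideal_mulK.
Qed.

End LeftIdealCoaction.

(** * Restriction of the coaction to the cotensor product *)

Section CotensorCoaction.
Context {k : fieldType} {H : hopfAlgType k} {e : H} {W : lmodType k}.
Context {rhoW : {linear W -> tensor W (hbar e)}}.
Implicit Types (X : lmodType k) (z : cotensor rhoW).

Lemma tlift_cotensor X (F : tensor W (hbar e) -> H -> X) (z : cotensor rhoW) :
  bilinear_for *:%R *:%R F ->
  \tsum_(w \ox x <- cotensor_val z) \tsum_(w0 \ox w1 <- rhoW w)
    F (w0 \ox w1) (left_ideal_val x) =
  \tsum_(w \ox x <- cotensor_val z)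
    \tsum_(x1 \ox x2 <- comul (left_ideal_val x)) F (w \ox hbar_proj e x1) x2.
Proof.
move=> bF; have /asboolP/(congr1 (tlift F)) := cotensor_valP z.
rewrite !(tlift_tlift _ _ bF) => E.
transitivity (\tsum_(w \ox x <- cotensor_val z)
    tlift F (\tsum_(w0 \ox w1 <- rhoW w) (w0 \ox w1 \ox left_ideal_val x))).
  apply: eq_tlift => w x; rewrite (tlift_tlift _ _ bF).
  by apply: eq_tlift => w0 w1; rewrite tlift_pure.
rewrite E; apply: eq_tlift => w x; rewrite (tlift_tlift _ _ bF).
by apply: eq_tlift => w0 w1; rewrite tlift_pure.
Qed.

(** Stability is checked one functional on [H] at a time. Both sides of the cotensor condition for
    the slice become the sum of [phi x_(3) *: (w \ox hbar_proj e x_(1) \ox x_(2) e)]: the left one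
    by the condition for [z], the right one by [tlift_hbar_proj]. *)
Lemma slice_ideal_coact (phi : {scalar H}) z :
  slice phi (ideal_coact (cotensor_val z)) \in cotensor_pred rhoW.
Proof.
pose L (w : W) (x : left_ideal e) :=
  \tsum_(w0 \ox w1 <- rhoW w) (w0 \ox w1 \ox left_ideal_val x).
pose R (w : W) (x : left_ideal e) :=
  \tsum_(x1 \ox x2 <- comul (left_ideal_val x)) (w \ox hbar_proj e x1 \ox x2).
have bL : bilinear_for *:%R *:%R L by rewrite /L; multilin.
have bR : bilinear_for *:%R *:%R R by rewrite /R; multilin.
have sliceE X (G : W -> left_ideal e -> X) : bilinear_for *:%R *:%R G ->
    tlift G (slice phi (ideal_coact (cotensor_val z))) =
    \tsum_(w \ox x <- cotensor_val z)
    \tsum_(x1 \ox x2 <- comul (left_ideal_val x))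
      (phi x2 *: G w (left_ideal_mul e x1)).
  move=> bG; rewrite /slice tlift_ideal_coact; last exact: slice_bilinear.
  rewrite (tlift_tlift _ _ bG); apply: eq_tlift => w x.
  rewrite (tlift_tlift _ _ bG); apply: eq_tlift => x1 x2.
  have lG := tlift_is_linear bG.
  have := lG (phi x2) (w \ox left_ideal_mul e x1) 0.
  by rewrite (linear_zero lG) !addr0 tlift_pure.
apply/asboolP; rewrite -/L -/R (sliceE _ L) // (sliceE _ R) //.
(* [F] performs the coaction and the slice on the last factor only, so the cotensor condition for
   [z] can be used underneath it. *)
pose F (p : tensor W (hbar e)) (x : H) :=
  \tsum_(x1 \ox x2 <- comul x) (phi x2 *: (p \ox (x1 * e))).
have bF : bilinear_for *:%R *:%R F by rewrite /F; multilin.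
transitivity (\tsum_(w \ox x <- cotensor_val z)
    \tsum_(w0 \ox w1 <- rhoW w) F (w0 \ox w1) (left_ideal_val x)).
  apply: eq_tlift => w x; rewrite /F exchange_tlift; apply: eq_tlift => x1 x2.
  by rewrite /L (@linear_tlift _ _ _ _ _ (fun t => phi x2 *: t)) //; multilin.
rewrite tlift_cotensor //; apply: eq_tlift => w x; rewrite /F.
rewrite -(@tlift_comulA _ _ _ (fun y1 y2 x2 =>
  phi x2 *: (w \ox hbar_proj e y1 \ox (y2 * e)))); first last.
- by move=> y1 y2; multilin.
- by move=> x2; multilin.
apply: eq_tlift => x1 x2.
rewrite -(@linear_tlift _ _ _ _ _ (fun t => phi x2 *: t)) //; last by multilin.
congr (_ *: _); rewrite /R /=.
rewrite (@tlift_comulM _ _ _ (fun y1 y2 => w \ox hbar_proj e y1 \ox y2));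
  last by multilin.
apply: eq_tlift => y1 y2.
rewrite (@tlift_hbar_proj _ _ _ _ (fun a b => w \ox a \ox (y2 * b))) //.
by multilin.
Qed.

(** A tensor all of whose slices lie in a subspace is a sum of pure tensors with first factors in
    that subspace ([tensor_set_slice]), and such a sum lifts term by term. *)
Lemma cotensor_coact_exists z : exists t : tensor (cotensor rhoW) H,
  \tsum_(y \ox h <- t) (cotensor_val y \ox h) = ideal_coact (cotensor_val z).
Proof.
have lA : linear_set (fun t => t \in cotensor_pred rhoW).
  by split=> [|a x y Ax Ay]; rewrite ?rpred0 // rpredD // rpredZ.
have [s sA ->] := tensor_set_slice lA (fun phi => slice_ideal_coact phi z).
(* The default [0] is never taken: every [p.1] satisfies [cotensor_pred]. *)
exists (tclass [seq (insubd (0 : cotensor rhoW) p.1, p.2) | p <- s]).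
rewrite tlift_class; last by multilin.
rewrite big_map; apply: eq_big_seq => p /sA[p1 _].
by rewrite [cotensor_val _](insubdK _ p1).
Qed.

Definition cotensor_coact z := sval (cid (cotensor_coact_exists z)).

Lemma cotensor_coactE z :
  \tsum_(y \ox h <- cotensor_coact z) (cotensor_val y \ox h) =
  ideal_coact (cotensor_val z).
Proof. by rewrite /cotensor_coact; case: cid. Qed.

(** The coaction is picked by choice, but injectivity of [cotensor_val] tensored with [H] makes the
    value unique, so linearity is inherited from [ideal_coact]. *)
Lemma cotensor_coact_linear : linear cotensor_coact.
Proof.
move=> a y z; apply: (tensor_mapl_inj (f := @cotensor_val _ _ _ _ rhoW)).
  exact: val_inj.
rewrite /= cotensor_coactE.
rewrite (linearP (@cotensor_val _ _ _ _ rhoW)) ideal_coact_is_linear.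
rewrite -!cotensor_coactE.
rewrite (@tlift_is_linear _ _ _ _ (fun y h => cotensor_val y \ox h)) //.
by multilin.
Qed.

HB.instance Definition _ := GRing.isLinear.Build k (cotensor rhoW)
  (tensor (cotensor rhoW) H) _ cotensor_coact cotensor_coact_linear.

End CotensorCoaction.

(* The first conjunct determines [rho], since [cotensor_val \ox id] is
   injective ([tensor_mapl_inj]). *)
Theorem corollary2p5 (k : fieldType) (H : hopfAlgType k) (e : H)
    (W : lmodType k) (rhoW : {linear W -> tensor W (hbar e)}) :
  subcentral_idempotent e -> right_comodule rhoW ->
  exists rho : {linear cotensor rhoW -> tensor (cotensor rhoW) H},
    (forall z : cotensor rhoW,
       \tsum_(y \ox h <- rho z) (cotensor_val y \ox h)
       = \tsum_(w \ox x <- cotensor_val z)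
         \tsum_(x1 \ox x2 <- comul (left_ideal_val x))
           (w \ox left_ideal_mul e x1 \ox x2))
    /\ right_partial_comodule rho.
Proof.
move=> e_sub _; exists (@cotensor_coact _ _ _ _ rhoW).
split; first exact: cotensor_coactE.
(* The axioms descend along [cotensor_val] from [W \ox left_ideal e]. *)
exact: right_partial_comodule_sub (@val_inj _ _ (cotensor rhoW))
  cotensor_coactE (ideal_coact_partial e_sub).
Qed.
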